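(* Let $\boldsymbol\lambda=(\lambda_i)_{i\in\mathbb N}$ and $\boldsymbol d=(d_i)_{i\in\mathbb N}$ be two sequences in $(0,1)$ which have accumulation points at $0$ and $1$. Assume that \[f_{\boldsymbol\lambda}(\alpha)\le f_{\boldsymbol d}(\alpha)<\infty\qquad\text{for all }\alpha\in(0,1),\] and \[f_{\boldsymbol\lambda}'(\alpha)\equiv f_{\boldsymbol d}'(\alpha)\mod 1\qquad\text{for some }\alpha\in(0,1).\] If $\boldsymbol\lambda$ is a diagonal of a self-adjoint operator $E$, then so is $\boldsymbol d$.
   Context: For a countable sequence $\boldsymbol d=(d_i)$ in $[0,1]$ and $\alpha\in(0,1)$, $f_{\boldsymbol d}(\alpha)=(1-\alpha)\sum_{d_i<\alpha}d_i+\alpha\sum_{d_i\ge\alpha}(1-d_i)\in[0,\infty]$. When finite it is piecewise linear on $(0,1)$; statements on derivatives at $\alpha$ mean that the functions involved are differentiable at $\alpha$. $x$ is an accumulation point of $(d_i)_{i\in I}$ if for every $\varepsilon>0$ there are infinitely many $i\in I$ with $|x-d_i|<\varepsilon$. A sequence $(d_i)$ is a diagonal of a (bounded) self-adjoint operator $E$ on a separable Hilbert space if $d_i=\langle Ee_i,e_i\rangle$ for all $i$, for some orthonormal basis $(e_i)$. *)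

(* Defs.v *)
From HB Require Import structures.
From mathcomp Require Export all_boot all_order all_algebra.
From mathcomp Require Export all_classical all_reals all_analysis.
From mathcomp Require Export complex.
Export Order.TTheory GRing.Theory Num.Theory.
Export numFieldNormedType.Exports.

Set Implicit Arguments.
Unset Strict Implicit.
Unset Printing Implicit Defensive.

Local Open Scope classical_set_scope.
Local Open Scope ring_scope.

Definition f_seq (R : realType) (d : nat -> R) (a : R) : \bar R :=
  ((1 - a)%:E * (\sum_(0 <= i <oo | (d i < a)%R) (d i)%:E)
   + a%:E * (\sum_(0 <= i <oo | (a <= d i)%R) (1 - d i)%:E))%E.

(* Counts indices, not values: repeated terms contribute, which is why this is
   not [limit_point (range d) x]. *)
Definition accumulation_point (R : realType) (d : nat -> R) (x : R) : Prop :=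
  forall e : R, 0 < e -> infinite_set [set i | `|x - d i| < e].

(* With [H : completeNormedModType R[i]] this makes [H] a complex Hilbert space; the
   form is linear in its first argument and conjugate-linear in its second. *)
Definition inner_product_norm (R : realType) (H : normedModType R[i])
    (ip : {dot H for Num.conj}) : Prop :=
  forall x : H, `|x| ^+ 2 = ip x x.

Definition bounded_self_adjoint (R : realType) (H : normedModType R[i])
    (ip : {dot H for Num.conj}) (E : {linear H -> H}) : Prop :=
  (exists M : R[i], forall x : H, `|E x| <= M * `|x|) /\
  (forall x y : H, ip (E x) y = ip x (E y)).

Definition orthonormal_basis (R : realType) (H : normedModType R[i])
    (ip : {dot H for Num.conj}) (e : nat -> H) : Prop :=
  (forall i j : nat, ip (e i) (e j) = (i == j)%:R) /\
  dense [set x : H | exists (n : nat) (c : nat -> R[i]),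
                       x = \sum_(i < n) c i *: e i].

Definition is_diagonal (R : realType) (H : normedModType R[i])
    (ip : {dot H for Num.conj}) (E : {linear H -> H}) (d : nat -> R) : Prop :=
  exists e : nat -> H, orthonormal_basis ip e /\
    forall i : nat, ip (E (e i)) (e i) = (d i)%:C%C.

(* Main.v *)
(* Idea. The sequences accumulate only at 0 and 1, so both can be listed increasingly
   along Z. Writing S k for the sum of the entries before k and T k for the sum of
   the 1 - u from k on, f_u(a) <= (1 - a) S k + a T k, with equality at a = u_k, and
   f_u' = T - S at a cut. The congruence of the derivatives lets us shift the
   indices so that T - S agrees for both sequences; then delta = S_d - S_lambda is
   nonnegative and tends to 0 at both ends.
   A plane rotation of two basis vectors moves diagonal mass between two indices.
   Near either end delta is small compared with gaps of lambda, so rotations on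
   pairwise disjoint intervals can bring delta to 0 at infinitely many places in both
   directions. Between two consecutive zeros only a finite majorization problem is
   left, solved by finitely many rotations. Every old basis vector is therefore a finite
   combination of new ones, so the new orthonormal system is again a basis. *)

Require Import Defs.
From mathcomp Require Import zify ring lra.

Set Implicit Arguments.
Unset Strict Implicit.
Unset Printing Implicit Defensive.

Local Open Scope classical_set_scope.
Local Open Scope ring_scope.

(** * Local changes of an orthonormal family *)

Section LocalChange.
Variables (C : numClosedFieldType) (U : lmodType C) (ip : {dot U for Num.conj}).

(** Finite combinations are built one term at a time with repetitions allowed, so closure properties
    follow by induction without tracking supports. *)
Inductive lspan (I : Type) (P : I -> Prop) (w : I -> U) : U -> Prop :=
| lspan0 : lspan P w 0
| lspanZD a i u : P i -> lspan P w u -> lspan P w (a *: w i + u).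

Lemma lspan_add I (P : I -> Prop) w u v :
  lspan P w u -> lspan P w v -> lspan P w (u + v).
Proof.
move=> Pu Pv; elim: Pu => [|a i u' Pi _ IH]; first by rewrite add0r.
by rewrite -addrA; exact: lspanZD.
Qed.

Lemma lspan_scale I (P : I -> Prop) w a u : lspan P w u -> lspan P w (a *: u).
Proof.
elim=> [|b i u' Pi _ IH]; first by rewrite scaler0; exact: lspan0.
by rewrite scalerDr scalerA; exact: lspanZD.
Qed.

Lemma lspan_gen I (P : I -> Prop) w i : P i -> lspan P w (w i).
Proof.
by move=> Pi; rewrite -[w i]addr0 -[w i]scale1r; apply: lspanZD => //; exact: lspan0.
Qed.

Lemma lspan_trans I J (P : I -> Prop) (Q : J -> Prop) w v u :
  (forall i, P i -> lspan Q v (w i)) -> lspan P w u -> lspan Q v u.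
Proof.
move=> PQ; elim=> [|a i u' Pi _ IH]; first exact: lspan0.
by apply: lspan_add => //; apply: lspan_scale; exact: PQ.
Qed.

Lemma lspan_sub I (P Q : I -> Prop) w u :
  (forall i, P i -> Q i) -> lspan P w u -> lspan Q w u.
Proof. by move=> PQ; apply: lspan_trans => i Pi; apply: lspan_gen; exact: PQ. Qed.

Lemma ipZl a u v : ip (a *: u) v = a * ip u v.
Proof. exact: linearZl_LR. Qed.

Lemma ipZr a u v : ip u (a *: v) = a^* * ip u v.
Proof. exact: linearZr_LR. Qed.

Lemma ip_sym0 u v : ip u v = 0 -> ip v u = 0.
Proof. by move=> uv; rewrite hermC /= uv rmorph0 mulr0. Qed.

Lemma lspan_ortho I J (P : I -> Prop) (Q : J -> Prop) w v a b :
  (forall i j, P i -> Q j -> ip (w i) (v j) = 0) ->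
  lspan P w a -> lspan Q v b -> ip a b = 0.
Proof.
move=> PQ Pa Qb.
have wb i : P i -> ip (w i) b = 0.
  move=> Pi; elim: Qb => [|c j u' Qj _ IH]; first by rewrite linear0r.
  by rewrite linearDr /= ipZr IH PQ // mulr0 addr0.
elim: Pa => [|c i u' Pi _ IH]; first by rewrite linear0l.
by rewrite linearDl /= ipZl IH wb // mulr0 addr0.
Qed.

Definition orthonormal_family (I : eqType) (e : I -> U) : Prop :=
  forall i j, ip (e i) (e j) = (i == j)%:R.

(** Both span inclusions are kept: the first keeps changes on disjoint index sets orthogonal, the
    second recovers the old vectors, which later gives completeness. *)
Definition local_change (I : eqType) (P : I -> Prop) (e v : I -> U) : Prop :=
  [/\ orthonormal_family v, forall i, ~ P i -> v i = e i,
      forall i, P i -> lspan P e (v i) & forall i, P i -> lspan P v (e i)].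

Lemma local_change_refl (I : eqType) (P : I -> Prop) e :
  orthonormal_family e -> local_change P e e.
Proof. by move=> oe; split=> // i Pi; exact: lspan_gen. Qed.

Lemma local_change_sub (I : eqType) (P Q : I -> Prop) e v :
  (forall i, P i -> Q i) -> local_change P e v -> local_change Q e v.
Proof.
move=> PQ [ov out ev ve]; split=> // i.
- by move=> nQ; apply: out => /PQ.
- move=> Qi; have [Pi|nPi] := pselect (P i); first by apply: lspan_sub PQ _; exact: ev.
  by rewrite out //; exact: lspan_gen.
- move=> Qi; have [Pi|nPi] := pselect (P i); first by apply: lspan_sub PQ _; exact: ve.
  by rewrite -out //; exact: lspan_gen.
Qed.

Lemma local_change_trans (I : eqType) (P : I -> Prop) e v w :
  local_change P e v -> local_change P v w -> local_change P e w.
Proof.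
move=> [_ out1 ev ve] [ow out2 vw wv]; split=> // i Pi.
- by rewrite out2 // out1.
- by apply: lspan_trans ev _; exact: vw.
- by apply: lspan_trans wv _; exact: ve.
Qed.

(** The fibres of [b] are disjoint, so new vectors from different fibres lie in spans of mutually
    orthogonal parts of [e]. Infinitely many changes can thus be made at once. *)
Lemma local_change_glue (I J : eqType) (b : I -> J) (e : I -> U) (v : J -> I -> U) :
  orthonormal_family e -> (forall j, local_change (fun i => b i = j) e (v j)) ->
  orthonormal_family (fun i => v (b i) i) /\
  forall i, lspan (fun=> True) (fun i => v (b i) i) (e i).
Proof.
move=> oe ch; split=> [i i'|i].
  have [bE|bN] := eqVneq (b i) (b i').
    by rewrite -bE; have [ov _ _ _] := ch (b i); exact: ov.
  have -> : (i == i') = false by apply/eqP => ii; rewrite ii eqxx in bN.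
  have [_ _ ev _] := ch (b i); have [_ _ ev' _] := ch (b i').
  apply: lspan_ortho (ev _ erefl) (ev' _ erefl) => k k' bk bk'.
  rewrite oe; case: eqVneq => // kk.
  by move: bN; rewrite -bk -bk' kk eqxx.
have [_ _ _ ve] := ch (b i).
apply: lspan_trans (ve _ erefl) => k bk.
by rewrite -bk; exact: (@lspan_gen _ (fun=> True) (fun i => v (b i) i) k).
Qed.

Variable E : {linear U -> U}.
Hypothesis E_sym : forall x y, ip (E x) y = ip x (E y).

Lemma unit_phase (w : C) : exists z : C, z * z^* = 1 /\ z * w + (z * w)^* = 0.
Proof.
have [->|w0] := eqVneq w 0.
  by exists 1; rewrite mulr0 rmorph0 addr0 rmorph1 mulr1.
have n0 : `|w| != 0 by rewrite normr_eq0.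
(* With this phase [z * w] equals ['i] times the modulus of [w], hence is purely imaginary. *)
exists ('i * w^* / `|w|).
have nr : `|w|^* = `|w| by apply/CrealP; rewrite normr_real.
have ww : w * w^* = `|w| ^+ 2 by rewrite normCK.
have ii := mulCii C.
split.
  rewrite !rmorphM /= fmorphV /= conjCi conjCK nr.
  have -> : 'i * w^* / `|w| * (- 'i * w / `|w|) =
    - ('i * 'i) * (w * w^*) / `|w| ^+ 2 by field.
  by rewrite ww ii opprK mul1r divff // expf_neq0.
have -> : 'i * w^* / `|w| * w = 'i * `|w|.
  have -> : 'i * w^* / `|w| * w = 'i * (w * w^*) / `|w| by field.
  by rewrite ww; field.
by rewrite rmorphM /= conjCi nr mulNr subrr.
Qed.

(* The phase [z] makes the cross term of [E] between [e] and [z *: f] purely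
   imaginary, so rotating this pair interpolates the diagonal entries. *)
Lemma rotation (e f : U) (p q r : C) :
  ip e e = 1 -> ip f f = 1 -> ip e f = 0 ->
  ip (E e) e = p -> ip (E f) f = q -> p <= r -> r <= q ->
  exists e' f' : U,
    [/\ [/\ ip e' e' = 1, ip f' f' = 1 & ip e' f' = 0],
        ip (E e') e' = r, ip (E f') f' = p + q - r,
        (exists a b c d, e' = a *: e + b *: f /\ f' = c *: e + d *: f) &
        exists a b c d, e = a *: e' + b *: f' /\ f = c *: e' + d *: f'].
Proof.
move=> ee ff ef Ee Ef pr rq.
have [pq|pq] := eqVneq p q.
  have rp : r = p by apply/eqP; rewrite eq_le pr andbT pq.
  exists e, f; split=> //; rewrite ?rp ?Ef -?pq ?addrK //.
  1,2: by exists 1, 0, 0, 1; rewrite !scale0r !scale1r addr0 add0r.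
have qp : q - p != 0 by rewrite subr_eq0 eq_sym.
have qp0 : 0 <= q - p by rewrite subr_ge0 (le_trans pr).
(* Cosine and sine of the rotation angle: their squares are the weights writing [r] as a convex
   combination of [p] and [q]. *)
pose c := sqrtC ((q - r) / (q - p)); pose s := sqrtC ((r - p) / (q - p)).
have c2 : c * c = (q - r) / (q - p) by rewrite -expr2 sqrtCK.
have s2 : s * s = (r - p) / (q - p) by rewrite -expr2 sqrtCK.
have cc : c^* = c.
  by apply/CrealP; rewrite sqrtC_real // divr_ge0 // subr_ge0.
have ss : s^* = s.
  by apply/CrealP; rewrite sqrtC_real // divr_ge0 // subr_ge0.
have cs1 : c * c + s * s = 1 by rewrite c2 s2; field.
have [z [zz zw]] := unit_phase (ip (E f) e).
have [g gE] : exists g, g = z *: f by exists (z *: f).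
have EZ a x : E (a *: x) = a *: E x by exact: linearZ.
have ED x y : E (x + y) = E x + E y by exact: linearD.
have fe := ip_sym0 ef.
have gg : ip g g = 1 by rewrite gE ipZl ipZr /= ff mulr1.
have eg : ip e g = 0 by rewrite gE ipZr /= ef mulr0.
have ge : ip g e = 0 by rewrite gE ipZl /= fe mulr0.
have Eg : ip (E g) g = q.
  by rewrite gE EZ ipZl ipZr /= Ef mulrA zz mul1r.
(* By symmetry of [E] the second term is the conjugate of the first, and the phase makes their sum
   vanish. *)
have cross : ip (E g) e + ip (E e) g = 0.
  rewrite [ip (E e) g]E_sym [ip e (E g)]hermC /= expr0 mul1r.
  by rewrite gE EZ ipZl /= zw.
have cross' : ip (E e) g = - ip (E g) e.
  by apply/eqP; rewrite -addr_eq0 addrC cross.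
pose e' := c *: e + s *: g; pose f' := (- s) *: e + c *: g.
exists e', f'; split.
- split; rewrite /e' /f' !(linearDl, linearDr) /= !(ipZl, ipZr)
    ?rmorphN /= ?cc ?ss ee gg eg ge.
  + by rewrite -[RHS]cs1; ring.
  + by rewrite -[RHS]cs1; ring.
  + by ring.
- rewrite /e' ED !EZ !(linearDl, linearDr) /= !(ipZl, ipZr).
  rewrite cc ss Ee Eg cross'.
  transitivity ((c * c) * p + (s * s) * q); first by ring.
  by rewrite c2 s2; field.
- rewrite /f' ED !EZ !(linearDl, linearDr) /= !(ipZl, ipZr).
  rewrite ?rmorphN /= cc ss Ee Eg cross'.
  transitivity ((s * s) * p + (c * c) * q); first by ring.
  by rewrite c2 s2; field.
- exists c, (s * z), (- s), (c * z).
  by rewrite /e' /f' gE !scalerA.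
- exists c, (- s), (z^* * s), (z^* * c).
  have eE : c *: e' + (- s) *: f' = e.
    rewrite /e' /f' !scalerDr !scalerA addrACA -!scalerDl.
    by rewrite mulrNN cs1 scale1r mulNr mulrC subrr scale0r addr0.
  have gE' : s *: e' + c *: f' = g.
    rewrite /e' /f' !scalerDr !scalerA addrACA -!scalerDl.
    by rewrite mulrN mulrC subrr scale0r add0r addrC cs1 scale1r.
  by split; rewrite ?eE // -!scalerA -scalerDr gE' gE scalerA mulrC zz scale1r.
Qed.

Lemma rotation_family (I : eqType) (e : I -> U) k l (r : C) :
  orthonormal_family e -> k != l ->
  ip (E (e k)) (e k) <= r -> r <= ip (E (e l)) (e l) ->
  exists v, [/\ local_change (fun i => i = k \/ i = l) e v,
    ip (E (v k)) (v k) = r &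
    ip (E (v l)) (v l) = ip (E (e k)) (e k) + ip (E (e l)) (e l) - r].
Proof.
move=> oe kl pr rq.
have kk : ip (e k) (e k) = 1 by rewrite oe eqxx.
have ll : ip (e l) (e l) = 1 by rewrite oe eqxx.
have kl0 : ip (e k) (e l) = 0 by rewrite oe (negbTE kl).
have [e' [f' [[ee ff ef] Er El [a [b [c [d [e'E f'E]]]]] [a' [b' [c' [d' [eE fE]]]]]]]] :=
  rotation kk ll kl0 erefl erefl pr rq.
pose v i := if i == k then e' else if i == l then f' else e i.
have vk : v k = e' by rewrite /v eqxx.
have vl : v l = f' by rewrite /v eq_sym (negbTE kl) eqxx.
exists v; split; rewrite ?vk ?vl //.
have ort x y i : i != k -> i != l -> ip (x *: e k + y *: e l) (e i) = 0.
  move=> ik il; rewrite linearDl /= !ipZl !oe.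
  by rewrite eq_sym (negbTE ik) eq_sym (negbTE il) !mulr0 addr0.
split.
- move=> i j; rewrite /v.
  have [-> {i}|ik] := eqVneq i k; have [jk|jk] := eqVneq j k => //.
  + by have [_|jl] := eqVneq j l; [rewrite ef|rewrite e'E ort].
  + rewrite jk (negbTE ik); have [_|il] := eqVneq i l; first by rewrite (ip_sym0 ef).
    by rewrite ip_sym0 // e'E ort.
  + have [iE|il] := eqVneq i l; have [jE|jl] := eqVneq j l.
    * by rewrite ff iE jE eqxx.
    * by rewrite f'E ort // iE eq_sym (negbTE jl).
    * by rewrite ip_sym0 ?jE ?(negbTE il) // f'E ort.
    * by rewrite oe.
- move=> i nP; rewrite /v; case: eqVneq => [ik|_]; first by case: nP; left.
  by case: eqVneq => // il; case: nP; right.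
- have sp x y : lspan (fun i => i = k \/ i = l) e (x *: e k + y *: e l).
    by apply: lspan_add; apply: lspan_scale; apply: lspan_gen; [left|right].
  by move=> i [->|->]; rewrite ?vk ?vl ?e'E ?f'E; exact: sp.
- have sp x y : lspan (fun i => i = k \/ i = l) v (x *: e' + y *: f').
    by rewrite -vk -vl; apply: lspan_add; apply: lspan_scale; apply: lspan_gen; [left|right].
  by move=> i [->|->]; rewrite ?eE ?fE; exact: sp.
Qed.

End LocalChange.

(** * Finite majorization *)

Section Horn.
Variables (R : realType) (I : eqType).
Implicit Types (x d : I -> R) (s : seq I).

(** Majorization with a carry: starting from [a], the partial sums of [d - x] along [s] stay
    nonnegative and end at zero. *)
Fixpoint majorized x d (a : R) s : Prop :=
  if s is i :: s' then 0 <= a + d i - x i /\ majorized x d (a + d i - x i) s'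
  else a = 0.

Definition upd x k (a : R) : I -> R := fun i => if i == k then a else x i.

Lemma eq_majorized x x' d a s :
  {in s, x =1 x'} -> majorized x d a s -> majorized x' d a s.
Proof.
elim: s a => //= i s IH a xx' [h1 h2].
rewrite -(xx' i) ?mem_head //; split => //.
by apply: IH h2 => j js; apply: xx'; rewrite inE js orbT.
Qed.

(** As long as [x i < r <= d i] the carry grows, yet it must end at zero, so some entry reaches [r].
    Taking [a] off the first such entry compensates for dropping [a] from the initial carry; before
    it, [b] alone stays nonnegative. *)
Lemma majorized_carry x d r a b s :
  uniq s -> 0 <= a -> 0 <= b -> {in s, forall i, r <= d i} ->
  majorized x d (a + b) s ->
  a + b = 0 \/
  exists l, [/\ l \in s, r <= x l & majorized (upd x l (x l - a)) d b s].
Proof.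
elim: s b => [|i s IH] b /=; first by left.
move=> /andP[is_ us] a0 b0 rd [h1 h2].
have [rx|xr] := leP r (x i).
  right; exists i; split; rewrite ?mem_head //.
  have e : b + d i - upd x i (x i - a) i = a + b + d i - x i.
    by rewrite /upd eqxx; ring.
  rewrite e; split=> //; apply: eq_majorized h2 => j js.
  by rewrite /upd; case: eqVneq => // ji; rewrite -ji js in is_.
have rdi := rd i (mem_head _ _).
have b'0 : 0 < b + d i - x i by lra.
have [||a0'|[l [ls rl m]]] := IH (b + d i - x i) us a0 (ltW b'0).
- by move=> j js; apply: rd; rewrite inE js orbT.
- by have -> : a + (b + d i - x i) = a + b + d i - x i by ring.
- by exfalso; lra.
right; exists l; split; rewrite ?inE ?ls ?orbT //.
have -> : upd x l (x l - a) i = x i.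
  by rewrite /upd; case: eqVneq => // il; rewrite il ls in is_.
by split=> //; exact: ltW.
Qed.

Variables (U : lmodType R[i]) (ip : {dot U for Num.conj}) (E : {linear U -> U}).
Hypothesis E_sym : forall u v, ip (E u) v = ip u (E v).

Definition has_diagonal (e : I -> U) x : Prop :=
  forall i, ip (E (e i)) (e i) = (x i)%:C%C.

Lemma transfer (e : I -> U) x k l (t : R) :
  orthonormal_family ip e -> has_diagonal e x -> k != l ->
  0 <= t -> t <= x l - x k ->
  exists v, local_change ip (fun i => i = k \/ i = l) e v /\
    has_diagonal v (upd (upd x k (x k + t)) l (x l - t)).
Proof.
move=> oe de kl t0 tx.
have [||v [ch vk vl]] := rotation_family (r := (x k + t)%:C%C) E_sym oe kl.
- by rewrite de lecR; lra.
- by rewrite de lecR; lra.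
exists v; split=> // i; rewrite /upd.
have [->|il] := eqVneq i l.
  by rewrite vl !de -rmorphD -rmorphB /=; congr (_ %:C%C); ring.
have [->|ik] := eqVneq i k; first by rewrite vk.
by case: ch => _ -> // [] /eqP; apply/negP.
Qed.

(* Each step settles the least remaining target [d k] by rotating [k] against the
   first later index whose current entry is at least [d k]. *)
Lemma horn d s (e : I -> U) x :
  orthonormal_family ip e -> has_diagonal e x -> uniq s ->
  pairwise (fun i j => d i <= d j) s -> majorized x d 0 s ->
  exists v, local_change ip (fun i => i \in s) e v /\
    has_diagonal v (fun i => if i \in s then d i else x i).
Proof.
elim: s e x => [|k s IH] e x oe de /=.
  by move=> _ _ _; exists e; split=> //; exact: local_change_refl.
move=> /andP[ks us] /andP[/allP kd sd] [h1 h2].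
rewrite add0r in h1 h2.
have [e1 [x1 [ch1 de1 x1k x1o m1]]] : exists e1 x1,
  [/\ local_change ip (fun i => i \in k :: s) e e1, has_diagonal e1 x1,
      x1 k = d k, forall i, i \notin k :: s -> x1 i = x i & majorized x1 d 0 s].
  have [||a0|[l [ls rl m]]] := majorized_carry (x := x) (d := d) (r := d k)
    (a := d k - x k) (b := 0) us h1 (lexx _).
  - by move=> i; exact: kd.
  - by rewrite addr0.
  - exists e, x; split=> //; first exact: local_change_refl.
      by rewrite addr0 in a0; lra.
    by have <- : d k - x k = 0 by rewrite addr0 in a0.
  have kl : k != l by apply: contraNneq ks => ->.
  have [|v [ch dv]] := transfer oe de kl h1; first by lra.
  exists v, (upd (upd x k (x k + (d k - x k))) l (x l - (d k - x k))); split=> //.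
  - by apply: local_change_sub ch => i [->|->]; rewrite inE ?eqxx ?ls ?orbT.
  - by rewrite /upd (negbTE kl) eqxx; ring.
  - move=> i; rewrite inE negb_or => /andP[ik is_]; rewrite /upd (negbTE ik).
    by case: eqVneq => // il; rewrite il ls in is_.
  - apply: eq_majorized m => i is_; rewrite /upd; case: eqVneq => // il.
    by case: eqVneq => // ik; rewrite -ik is_ in ks.
have [v [ch dv]] := IH e1 x1 (let: And4 o _ _ _ := ch1 in o) de1 us sd m1.
exists v; split.
  apply: local_change_trans ch1 _.
  by apply: local_change_sub ch => i is_; rewrite inE is_ orbT.
move=> i; rewrite dv inE; case: (boolP (i \in s)) => is_; rewrite ?orbT // orbF.
have [->|ik] := eqVneq i k; first by rewrite x1k.
by rewrite x1o // inE negb_or ik.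
Qed.

End Horn.

(** * Transport along the integers *)

Section Windows.

(** A strictly increasing integer sequence moves by at least one per step, so it is unbounded both
    ways and its windows cover the integers. *)
Lemma int_windows (c : int -> int) : (forall j, c j < c (j + 1)) ->
  exists b : int -> int, forall i, c (b i) <= i < c (b i + 1).
Proof.
move=> cS.
have cD (n : nat) j : c j + n%:Z <= c (j + n%:Z).
  elim: n => [|n IH]; first by rewrite !addr0.
  have := cS (j + n%:Z); have -> : j + n.+1%:Z = j + n%:Z + 1 by lia.
  by lia.
suff /choice[b bP] : forall i, exists j, c j <= i < c (j + 1) by exists b.
move=> i.
have [j cj] : exists j, c j <= i.
  have [N cN] : exists N : nat, c 0 - i <= N%:Z by exists (absz (c 0 - i)); move: (c 0) => y; lia.
  by exists (- N%:Z); have := cD N (- N%:Z); rewrite addNr; move: (c 0) cN => y; lia.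
have ex : exists n : nat, i < c (j + n%:Z).
  by exists (`|i - c j|%N.+1); have := cD (`|i - c j|%N.+1) j; lia.
case: (ex_minnP ex) => [[|n]] nP nmin; first by move: nP; rewrite addr0; lia.
exists (j + n%:Z); have -> : j + n%:Z + 1 = j + n.+1%:Z by lia.
rewrite nP andbT leNgt; apply/negP => lt.
by have := nmin n lt; lia.
Qed.

Lemma int_homo (c : int -> int) : (forall j, c j < c (j + 1)) ->
  forall i j, i <= j -> c i <= c j.
Proof.
move=> cS i j ij; have -> : j = i + `|j - i|%N%:Z by lia.
elim: `|j - i|%N => [|n IH]; first by rewrite addr0.
have := cS (i + n%:Z); have -> : i + n.+1%:Z = i + n%:Z + 1 by lia.
by lia.
Qed.

Lemma window_uniq (c : int -> int) : (forall j, c j < c (j + 1)) ->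
  forall i j j', c j <= i < c (j + 1) -> c j' <= i < c (j' + 1) -> j = j'.
Proof.
move=> cS i j j' h h'; have mono := int_homo cS.
have [lt|gt|//] := ltgtP j j'.
- have : c (j + 1) <= c j' by apply: mono; lia.
  by lia.
- have : c (j' + 1) <= c j by apply: mono; lia.
  by lia.
Qed.

Lemma window_sequence (G : int -> int -> Prop) :
  (forall p, exists q, p < q /\ G p q) -> (forall q, exists p, p < q /\ G p q) ->
  exists c : int -> int, forall j, c j < c (j + 1) /\ G (c j) (c (j + 1)).
Proof.
move=> /choice[F FP] /choice[B BP].
(* Successors are iterated to the right of 0 and predecessors to the left; [Negz n] is [-(n+1)],
   hence the [n.+1] iterations. *)
exists (fun j => match j with Posz n => iter n F 0 | Negz n => iter n.+1 B 0 end).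
case=> n.
  have -> : Posz n + 1 = Posz n.+1 by lia.
  exact: FP.
case: n => [|n].
  have -> : Negz 0 + 1 = Posz 0 by lia.
  exact: BP.
have -> : Negz n.+1 + 1 = Negz n by lia.
exact: BP.
Qed.

End Windows.

(** * Cancelling the excess of partial sums window by window *)

Section Transport.
Variables (R : realType).
Implicit Types (x y delta : int -> R).

Lemma int_argmin delta a (n : nat) :
  exists m, a <= m <= a + n%:Z /\ forall i, a <= i <= a + n%:Z -> delta m <= delta i.
Proof.
elim: n => [|n [m [ma mmin]]].
  by exists a; split=> [|i ia]; [lia | have -> : i = a by lia].
have [le|lt] := leP (delta m) (delta (a + n.+1%:Z)).
  exists m; split=> [|i ia]; first by lia.
  by have [->//|ni] := eqVneq i (a + n.+1%:Z); apply: mmin; lia.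
exists (a + n.+1%:Z); split=> [|i ia]; first by lia.
have [->//|ni] := eqVneq i (a + n.+1%:Z).
by apply: (le_trans (ltW lt)); apply: mmin; lia.
Qed.

(** Moving the amount [delta m] from entry [l] to entry [k] lowers [delta] by [delta m] exactly on
    [k < i <= l]. The conditions make the rotation possible, keep [delta] nonnegative and create a
    zero at [m]. *)
Definition transfer_site x delta (p q k m l : int) : Prop :=
  [/\ p <= k < m, m <= l < q, delta m <= x l - x k &
      forall i, k < i <= l -> delta m <= delta i].

(** Take for [m] a minimizer of [delta] on [k < j <= l]; the bound known at [i] passes to it. *)
Lemma transfer_site_ex x delta (p q k i l : int) :
  p <= k < i -> i <= l < q -> delta i <= x l - x k ->
  exists k m l, transfer_site x delta p q k m l.
Proof.
move=> ki il di; have [m [mk mmin]] := int_argmin delta (k + 1) (absz (l - (k + 1))%R).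
have mm j : k < j <= l -> delta m <= delta j by move=> h; apply: mmin; lia.
exists k, m, l; split=> //; try lia.
by apply: le_trans di; apply: mm; lia.
Qed.

(** [x] and [y] play the old and the new diagonal in increasing order, and [delta] the excess of the
    partial sums of [y] over those of [x]. *)
Variables (x y delta : int -> R).
Hypothesis x_homo : {homo x : i j / i <= j}.
Hypothesis y_homo : {homo y : i j / i <= j}.
Hypothesis x_up : forall k, exists l, x k < x l.
Hypothesis x_down : forall l, exists k, x k < x l.
Hypothesis deltaS : forall k, delta (k + 1) = delta k + y k - x k.
Hypothesis delta_ge0 : forall k, 0 <= delta k.
Hypothesis delta_right : forall eps N, 0 < eps -> exists i, N < i /\ delta i < eps.
Hypothesis delta_left : forall eps N, 0 < eps -> exists i, i < N /\ delta i < eps.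

Lemma transfer_sites : exists c k m l : int -> int,
  forall j, c j < c (j + 1) /\ transfer_site x delta (c j) (c (j + 1)) (k j) (m j) (l j).
Proof.
have [||c cP] := @window_sequence (fun p q => exists k m l, transfer_site x delta p q k m l).
- move=> p; have [l0 pl] := x_up p.
  (* Beyond [l0] the gap [x i - x p] is at least the fixed number [x l0 - x p], while [delta]
     becomes smaller than it. The window from [p] to [i + 1] then has a site with [k = p] and
     [l = i]. *)
  have [i [iN di]] : exists i, Num.max p l0 < i /\ delta i < x l0 - x p.
    by apply: delta_right; lra.
  exists (i + 1); split; first by lia.
  apply: (@transfer_site_ex _ _ _ _ p i i); try lia.
  have : x l0 <= x i by apply: x_homo; lia.
  by lra.
- move=> q; have [k0 kl] := x_down (q - 1).
  (* Mirror image: the window starts at [i - 1], with [k = i - 1] and [l = q - 1]. *)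
  have [i [iN di]] : exists i, i < Num.min (q - 1) k0 /\ delta i < x (q - 1) - x k0.
    by apply: delta_left; lra.
  exists (i - 1); split; first by lia.
  apply: (@transfer_site_ex _ _ _ _ (i - 1) i (q - 1)); try lia.
  have : x (i - 1) <= x k0 by apply: x_homo; lia.
  by lra.
have /choice[k kP] : forall j, exists k, exists m l,
  transfer_site x delta (c j) (c (j + 1)) k m l by move=> j; case: (cP j).
have /choice[m mP] := kP; have /choice[l lP] := mP.
by exists c, k, m, l => j; split=> //; case: (cP j).
Qed.

(** Along consecutive integers the carry of [majorized] is [delta'] itself. *)
Lemma majorized_iota delta' x' a (n : nat) :
  (forall i, delta' (i + 1) = delta' i + y i - x' i) ->
  (forall i, 0 <= delta' i) -> delta' (a + n%:Z) = 0 ->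
  majorized x' y (delta' a) [seq a + i%:Z | i <- iota 0 n].
Proof.
move=> dS d0; elim: n a => [|n IH] a /=; first by rewrite addr0.
move=> an; rewrite addr0 -dS; split => //.
have -> : [seq a + i%:Z | i <- iota 1 n] = [seq a + 1 + i%:Z | i <- iota 0 n].
  by rewrite (iotaDl 1 0) -map_comp; apply: eq_map => i /=; lia.
by apply: IH; have -> : a + 1 + n%:Z = a + n.+1%:Z by lia.
Qed.

Variables (U : lmodType R[i]) (ip : {dot U for Num.conj}) (E : {linear U -> U}).
Hypothesis E_sym : forall u v, ip (E u) v = ip u (E v).

(* [delta] is brought to zero at the sites [m j] by one rotation per window; between
   two consecutive zeros only a finite majorization problem remains. *)
Lemma transport (e : int -> U) :
  orthonormal_family ip e -> has_diagonal ip E e x ->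
  exists v, [/\ orthonormal_family ip v, has_diagonal ip E v y &
    forall i, lspan (fun=> True) v (e i)].
Proof.
move=> oe de.
have [c [k [m [l site]]]] := transfer_sites.
have cS j : c j < c (j + 1) by case: (site j).
have [b bP] := int_windows cS.
have b_uniq i j : c j <= i < c (j + 1) -> b i = j.
  by move=> h; apply: (window_uniq cS) (bP i) h.
pose t j := delta (m j).
have /choice[v1 v1P] : forall j, exists v, local_change ip (fun i => b i = j) e v /\
    has_diagonal ip E v (upd (upd x (k j) (x (k j) + t j)) (l j) (x (l j) - t j)).
  move=> j; have [_ [ck lc tl _]] := site j.
  have kl : k j != l j by apply/eqP; lia.
  have [v [ch dv]] := transfer E_sym oe de kl (delta_ge0 _) tl.
  exists v; split=> //; apply: local_change_sub ch => i [->|->]; apply: b_uniq; lia.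
(* The excess after the rotation in window [j]; [delta'] below collects these for all windows. *)
pose phi j i := if k j < i <= l j then delta i - t j else delta i.
pose delta' i := phi (b i) i.
pose e' i := v1 (b i) i.
pose x' i := upd (upd x (k (b i)) (x (k (b i)) + t (b i))) (l (b i)) (x (l (b i)) - t (b i)) i.
have [oe' ee'] : orthonormal_family ip e' /\ forall i, lspan (fun=> True) e' (e i).
  by apply: local_change_glue oe _ => j; case: (v1P j).
have de' : has_diagonal ip E e' x' by move=> i; have [_ ->] := v1P (b i).
have delta'S i : delta' (i + 1) = delta' i + y i - x' i.
  (* Only at the right end of a window does [i + 1] belong to the next one. There both values of
     [phi] are plain [delta], since [l j < c (j + 1) <= k (j + 1)]. *)
  have -> : delta' (i + 1) = phi (b i) (i + 1).
    have [i1|i1] := leP (c (b i + 1)) (i + 1); last first.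
      by rewrite /delta' (b_uniq (i + 1) (b i)) //; have := bP i; lia.
    have bi1 : b (i + 1) = b i + 1.
      by apply: b_uniq; have := bP i; have := cS (b i + 1); lia.
    rewrite /delta' bi1 /phi; have [_ [h1 h2 _ _]] := site (b i).
    have [_ [h3 h4 _ _]] := site (b i + 1); have := bP i => h5.
    by rewrite !ifN //; lia.
  have [_ [h1 h2 _ _]] := site (b i).
  rewrite /delta' /x' /phi /upd deltaS; move: (b i) h1 h2 => j h1 h2.
  have [il|il] := eqVneq i (l j).
    by rewrite ifF ?ifT -?il; [ring|lia|lia].
  have [ik|ik] := eqVneq i (k j).
    by rewrite ifT ?ifF -?ik; [ring|lia|lia].
  have -> : (k j < i + 1 <= l j) = (k j < i <= l j) by lia.
  by case: ifP => _; ring.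
have delta'_ge0 i : 0 <= delta' i.
  rewrite /delta' /phi; case: ifP => // kil; rewrite subr_ge0.
  by have [_ [_ _ _]] := site (b i); apply.
have delta'm j : delta' (m j) = 0.
  have [_ [h1 h2 _ _]] := site j.
  rewrite /delta' (b_uniq (m j) j); last by lia.
  by rewrite /phi ifT ?subrr //; lia.
have mS j : m j < m (j + 1).
  by have [_ [h1 h2 _ _]] := site j; have [_ [h3 h4 _ _]] := site (j + 1); lia.
(* The integers are cut anew, now at the zeros [m j] of [delta'], so that each piece starts and ends
   with carry zero. *)
have [b' b'P] := int_windows mS.
have b'_uniq i j : m j <= i < m (j + 1) -> b' i = j.
  by move=> h; apply: (window_uniq mS) (b'P i) h.
have /choice[v2 v2P] : forall j, exists v, local_change ip (fun i => b' i = j) e' v /\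
    forall i, b' i = j -> ip (E (v i)) (v i) = (y i)%:C%C.
  move=> j; pose n := absz (m (j + 1) - m j)%R.
  have mn : m j + n%:Z = m (j + 1) by have := mS j; rewrite /n; lia.
  pose s := [seq m j + i%:Z | i <- iota 0 n].
  have sP i : (i \in s) = (b' i == j).
    apply/mapP/eqP => [[i0]|bi].
      by rewrite mem_iota => i0n ->; apply: b'_uniq; lia.
    have := b'P i; rewrite bi => ib; exists (absz (i - m j)%R); rewrite ?mem_iota; lia.
  have maj : majorized x' y 0 s.
    by rewrite -(delta'm j); apply: majorized_iota => //; rewrite mn.
  have us : uniq s by rewrite map_inj_uniq ?iota_uniq // => i i'; lia.
  have ys : pairwise (fun i j => y i <= y j) s.
    rewrite pairwise_map; have := iota_ltn_sorted 0 n; rewrite ltn_sorted_uniq_leq.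
    move=> /andP[_]; rewrite (sorted_pairwise leq_trans); apply: sub_pairwise => i i' ii.
    by apply: y_homo; lia.
  have [v [ch dv]] := horn E_sym oe' de' us ys maj.
  exists v; split; first by apply: local_change_sub ch => i; rewrite sP => /eqP.
  by move=> i bi; rewrite dv sP bi eqxx.
have [ov ev] := local_change_glue oe' (fun j => proj1 (v2P j)).
exists (fun i => v2 (b' i) i); split=> // i.
  by have [_ ->] := v2P (b' i).
by apply: lspan_trans (ee' i) => i' _; exact: ev.
Qed.

End Transport.

(** * Increasing enumeration along the integers *)

Section Sorting.
Variables (R : realType) (w : nat -> R) (Q : pred nat).

Lemma seq_argmax (s : seq nat) i0 : i0 \in s ->
  exists2 i, i \in s & forall j, j \in s -> w j <= w i.
Proof.
elim: s i0 => // k s IH i0 _; case: s IH => [|l s] IH.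
  by exists k => [|j]; rewrite inE // => /eqP ->.
have [i is_ imax] := IH l (mem_head _ _).
have [ki|ik] := leP (w k) (w i).
  exists i => [|j]; first by rewrite inE is_ orbT.
  by rewrite inE => /orP[/eqP -> //|]; exact: imax.
exists k => [|j]; first exact: mem_head.
rewrite inE => /orP[/eqP -> //|js].
exact: le_trans (imax _ js) (ltW ik).
Qed.

Hypothesis Q_inf : infinite_set [set i | Q i].
Hypothesis w_gt0 : forall i, Q i -> 0 < w i.
Hypothesis w_small : forall eps, 0 < eps ->
  exists N, forall i, (N <= i)%N -> Q i -> w i < eps.

Lemma decreasing_enumeration : exists s : nat -> nat,
  [/\ injective s, forall n, Q (s n), forall i, Q i -> exists n, s n = i &
      forall n, w (s n.+1) <= w (s n)].
Proof.
have /choice[next nextP] : forall L : seq nat, exists i,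
    [/\ Q i, i \notin L & forall j, Q j -> j \notin L -> w j <= w i].
  move=> L.
  have [i0 [Qi0 i0L]] : exists i, Q i /\ i \notin L.
    apply: contrapT => nex; apply: Q_inf; apply: sub_finite_set (finite_seq L) => i /= Qi.
    by apply: contrapT => /negP iL; apply: nex; exists i.
  have [N NP] := w_small (w_gt0 Qi0).
  (* Indices from [N] on weigh less than [w i0], so the maximum is sought among finitely many;
     [i0.+1] keeps [i0] among them. *)
  pose s := [seq i <- iota 0 (maxn N i0.+1) | Q i && (i \notin L)].
  have [|i] := @seq_argmax s i0.
    by rewrite mem_filter Qi0 i0L mem_iota /=; lia.
  rewrite mem_filter => /andP[/andP[Qi iL] _] imax; exists i; split=> // j Qj jL.
  have [jN|Nj] := ltnP j (maxn N i0.+1).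
    by apply: imax; rewrite mem_filter Qj jL mem_iota.
  apply: (@le_trans _ _ (w i0)); first by apply/ltW/NP => //; lia.
  by apply: imax; rewrite mem_filter Qi0 i0L mem_iota /=; lia.
pose L := fix L n := if n is n'.+1 then next (L n') :: L n' else [::].
pose s n := next (L n).
have Lmono n m : (n <= m)%N -> {subset L n <= L m}.
  move=> nm; rewrite -(subnK nm); elim: (m - n)%N => // k IH i iL.
  by rewrite addSn /= inE IH ?orbT.
have sL n m : (n < m)%N -> s n \in L m.
  by move=> nm; apply: (Lmono n.+1) => //=; exact: mem_head.
have Ls n i : i \in L n -> exists m, s m = i.
  elim: n => //= n IH; rewrite inE => /orP[/eqP ->|/IH //].
  by exists n.
have s_inj : injective s.
  move=> n m nm; have [_ nL _] := nextP (L n); have [_ mL _] := nextP (L m).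
  have [nltm|mltn|//] := ltngtP n m.
    by have := sL _ _ nltm; rewrite nm /s (negbTE mL).
  by have := sL _ _ mltn; rewrite -nm /s (negbTE nL).
exists s; split=> //.
- by move=> n; have [] := nextP (L n).
- move=> i Qi; apply: contrapT => nex.
  have iL n : i \notin L n by apply/negP => /Ls.
  have [N NP] := w_small (w_gt0 Qi).
  (* An index never chosen would be outweighed by every chosen one, forcing infinitely many distinct
     choices below [N]. *)
  have sN n : (s n < N)%N.
    rewrite ltnNge; apply/negP => Ns; have [Qs _ smax] := nextP (L n).
    by have := NP _ Ns Qs; rewrite ltNge smax.
  have := @uniq_leq_size _ [seq s n | n <- iota 0 N.+1] (iota 0 N).
  rewrite map_inj_uniq ?iota_uniq // size_map !size_iota ltnn => h.
  by apply: notF; apply: h => // j /mapP[n _ ->]; rewrite mem_iota /= sN.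
- move=> n; have [_ _ smax] := nextP (L n); have [Qs sL' _] := nextP (L n.+1).
  by apply: smax => //; move: sL'; rewrite /= inE negb_or => /andP[].
Qed.

End Sorting.

(** * Tails of nonnegative series *)

Section Series.
Variables (R : realType) (w : nat -> R).
Hypothesis w_ge0 : forall i, 0 <= w i.
Implicit Types (P Q : pred nat).

Definition psum (P : pred nat) : \bar R := (\sum_(0 <= i <oo | P i) (w i)%:E)%E.

Lemma psum_ge0 P : (0 <= psum P)%E.
Proof. by apply: nneseries_ge0 => i _ _; rewrite lee_fin. Qed.

Lemma psum_pick P Q k : P k -> (forall i, Q i = P i && (i != k)) ->
  psum P = ((w k)%:E + psum Q)%E.
Proof.
move=> Pk QP; rewrite /psum (nneseriesD1 _ Pk).
  by congr (_ + _)%E; apply: eq_eseriesl => i; rewrite QP.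
by move=> i _; rewrite lee_fin.
Qed.

Lemma psum_tail P eps : (psum P < +oo)%E -> 0 < eps ->
  exists N, (\sum_(N <= i <oo | P i) (w i)%:E < eps%:E)%E.
Proof.
move=> Pfin e0.
have cv := @nneseries_tail_cvg _ (fun i => (w i)%:E) P Pfin
  (fun i _ => w_ge0 i : (0 <= (w i)%:E)%E).
have [N _ NP] : \forall N \near \oo, (\sum_(N <= i <oo | P i) (w i)%:E < eps%:E)%E.
  by apply: (cv [set x | (x < eps%:E)%E]); apply: open_ereal_lt'; rewrite lte_fin.
by exists N; apply: NP => /=.
Qed.

Lemma psum_small Q eps : (psum Q < +oo)%E -> 0 < eps ->
  exists N, forall i, (N <= i)%N -> Q i -> w i < eps.
Proof.
move=> Qfin e0; have [N NP] := psum_tail Qfin e0.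
exists N => i Ni Qi; rewrite -lte_fin; apply: le_lt_trans NP.
apply: le_trans (nneseries_lim_ge i.+1 _); last by move=> j _ _; rewrite lee_fin.
rewrite big_mkcond big_nat_recr //= Qi leeDr // sume_ge0 // => j _.
by case: ifP; rewrite // lee_fin.
Qed.

(** A tail of the sum over [D 0] is below [eps], and the decreasing sets [D n] eventually avoid the
    finitely many indices before that tail. *)
Lemma psum_inter_small (D : nat -> pred nat) eps :
  (forall n i, D n.+1 i -> D n i) -> (forall i, exists n, ~~ D n i) ->
  (psum (D 0%N) < +oo)%E -> 0 < eps ->
  exists n0, forall n, (n0 <= n)%N -> (psum (D n) < eps%:E)%E.
Proof.
move=> DS Dout fin e0; have [N NP] := psum_tail fin e0.
have Dmono n m i : (n <= m)%N -> D m i -> D n i.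
  by move=> nm; rewrite -(subnK nm); elim: (m - n)%N => // k IH; rewrite addSn => /DS.
have [n0 n0P] : exists n0, forall i, (i < N)%N -> ~~ D n0 i.
  elim: N {NP} => [|N [n0 n0P]]; first by exists 0%N.
  have [n1 n1P] := Dout N; exists (maxn n0 n1) => i; rewrite ltnS leq_eqVlt.
  move=> /orP[/eqP ->|iN]; first by apply: contra n1P; apply: Dmono; lia.
  by apply: contra (n0P i iN); apply: Dmono; lia.
exists n0 => n n0n; apply: le_lt_trans NP.
rewrite /psum (nneseries_split_cond 0 N); last by move=> j _; rewrite lee_fin.
rewrite add0n big1_seq ?add0e; last first.
  move=> i /andP[Di]; rewrite mem_index_iota => /andP[_ iN].
  by move: (n0P i iN); rewrite (Dmono n0 n).
rewrite eseries_mkcond [leRHS]eseries_mkcond.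
apply: lee_nneseries => i _.
  by case: ifP; rewrite // lee_fin.
by case: ifP => [/(Dmono 0%N)->//|_]; case: ifP; rewrite // lee_fin.
Qed.

End Series.

(** * Cuts of a sequence, the function f and its derivative *)

Lemma int_iff_ind (Q : int -> Prop) : (forall k, Q k <-> Q (k + 1)) -> Q 0 ->
  forall k, Q k.
Proof.
move=> QS Q0 [n|n].
  elim: n => // n /QS; by have -> : Posz n + 1 = Posz n.+1 by lia.
elim: n => [|n IH]; apply/QS; first by have -> : Negz 0 + 1 = 0 by lia.
by have -> : Negz n.+1 + 1 = Negz n by lia.
Qed.

(** Once differentiability is given, left difference quotients alone determine the derivative. *)
Lemma derive1_left_affine (R : realType) (f : R -> R) (a eta p q : R) :
  0 < eta -> derivable f a 1 ->
  (forall t, a - eta < t <= a -> f t = p + q * t) -> derive1 f a = q.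
Proof.
move=> eta0 df faff; rewrite /derive1.
have cv : cvg (h^-1 *: (f (h + a) - f a) @[h --> 0^']).
  by move: df; rewrite /derivable; under eq_fun do rewrite /= [_ *: 1]mulr1.
rewrite cvg_at_leftE //; apply/cvg_lim => //.
apply: cvg_near_cst; near=> h.
have h0 : h < 0 by near: h; exact: nbhs_left_lt.
have he : - eta < h by near: h; apply: nbhs_left_gt; lra.
rewrite !faff; [|lra|lra].
rewrite /GRing.scale /=; have -> : p + q * (h + a) - (p + q * a) = h * q by ring.
by rewrite mulKf // lt_eqF.
Unshelve. all: by end_near. Qed.

Lemma min_le2 (R : realType) (x y : R) : (Num.min x y <= x) && (Num.min x y <= y).
Proof. by rewrite !ge_min !lexx orbT. Qed.

Section Enumeration.
Variables (R : realType) (u : nat -> R).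

(** [sigma] lists [u] along the integers with inverse [tau]; [S k] stands for the sum of the entries
    before [k], [T k] for that of their complements to 1 from [k] on. *)
Record enumeration (sigma : int -> nat) (tau : nat -> int) (S T : int -> R) : Prop :=
  Enumeration {
    enum_sigmaK : cancel sigma tau;
    enum_tauK : cancel tau sigma;
    enum_homo : {homo (fun k => u (sigma k)) : i j / i <= j};
    enum_S : forall k, S (k + 1) = S k + u (sigma k);
    enum_T : forall k, T (k + 1) = T k - (1 - u (sigma k));
    enum_S_ge0 : forall k, 0 <= S k;
    enum_T_ge0 : forall k, 0 <= T k;
    enum_S_small : forall eps N, 0 < eps -> exists i, i < N /\ S i < eps;
    enum_T_small : forall eps N, 0 < eps -> exists i, N < i /\ T i < eps;
    enum_f_le : forall a k, 0 < a < 1 ->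
      (f_seq u a <= ((1 - a) * S k + a * T k)%:E)%E;
    enum_f_eq : forall k, f_seq u (u (sigma k)) =
      ((1 - u (sigma k)) * S k + u (sigma k) * T k)%:E }.

Hypothesis u01 : forall i, 0 < u i < 1.
Local Notation u' := (fun i => 1 - u i).

Let u_ge0 i : 0 <= u i. Proof. by case/andP: (u01 i) => /ltW. Qed.
Let u'_ge0 i : 0 <= 1 - u i. Proof. by rewrite subr_ge0; case/andP: (u01 i) => _ /ltW. Qed.

(** Merging both sums into one series lets different cuts be compared term by term. *)
Lemma cut_series (P : pred nat) a : 0 <= a <= 1 ->
  ((1 - a)%:E * psum u P + a%:E * psum u' (predC P) =
   \sum_(0 <= i <oo) (if P i then (1 - a) * u i else a * (1 - u i))%:E)%E.
Proof.
move=> /andP[a0 a1]; have a'0 : 0 <= 1 - a by lra.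
rewrite /psum -!nneseriesZl; first last.
- by move=> i _; rewrite lee_fin.
- by move=> i _; rewrite lee_fin.
rewrite eseries_mkcond [X in (_ + X)%E]eseries_mkcond -nneseriesD; first last.
- by move=> i _ _; case: ifP => _ //; rewrite -EFinM lee_fin mulr_ge0.
- by move=> i _ _; case: ifP => _ //; rewrite -EFinM lee_fin mulr_ge0.
apply: eq_eseriesr => i _ /=.
by case: (P i); rewrite /= ?adde0 ?add0e -EFinM.
Qed.

Lemma f_seqE a : f_seq u a =
  ((1 - a)%:E * psum u (fun i => (u i < a)%R)
    + a%:E * psum u' (predC (fun i => (u i < a)%R)))%E.
Proof.
rewrite /f_seq /psum; congr (_ + _ * _)%E; apply: eq_eseriesl => i /=.
by rewrite leNgt.
Qed.

Variable a : R.
Hypothesis a01 : 0 < a < 1.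
Hypothesis fa_fin : (f_seq u a < +oo)%E.

Let low i := u i < a.

Lemma psum_low_fin : (psum u low < +oo)%E.
Proof.
have a01' := a01; rewrite ltey; apply/eqP => e; move: fa_fin; rewrite f_seqE -/low e.
rewrite gt0_muley ?lte_fin; last lra.
rewrite addye ?ltxx // gt_eqF // (lt_le_trans ltNy0) // mule_ge0 ?psum_ge0 //.
by rewrite lee_fin; lra.
Qed.

Lemma psum_high_fin : (psum u' (predC low) < +oo)%E.
Proof.
have a01' := a01; rewrite ltey; apply/eqP => e; move: fa_fin; rewrite f_seqE -/low e.
rewrite [(a%:E * _)%E]gt0_muley ?lte_fin; last lra.
rewrite addey ?ltxx // gt_eqF // (lt_le_trans ltNy0) // mule_ge0 ?psum_ge0 //.
by rewrite lee_fin; lra.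
Qed.

(** The entries below [a] are summable, so only finitely many of them exceed [a / 2]. *)
Lemma low_gap : exists2 eta, 0 < eta & forall i, u i < a -> u i <= a - eta.
Proof.
have a01' := a01; have [|N NP] := @psum_small _ _ u_ge0 low (a / 2) psum_low_fin; first lra.
have : exists2 eta, 0 < eta & forall i, (i < N)%N -> u i < a -> u i <= a - eta.
  elim: N {NP} => [|N [eta e0 IH]]; first by exists 1.
  have [ua|ua] := ltP (u N) a.
    exists (Num.min eta (a - u N)); first by rewrite lt_min e0; lra.
    move=> i; rewrite ltnS leq_eqVlt => /orP[/eqP ->|iN] ui.
      by have /andP[_] := min_le2 eta (a - u N); lra.
    by have := IH i iN ui; have /andP[] := min_le2 eta (a - u N); lra.
  exists eta => // i; rewrite ltnS leq_eqVlt => /orP[/eqP ->|iN] ui; first lra.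
  exact: IH.
move=> [eta e0 IH]; exists (Num.min eta (a / 2)); first by rewrite lt_min e0; lra.
have /andP[m1 m2] := min_le2 eta (a / 2).
move=> i ui; have [iN|Ni] := ltnP i N; first by have := IH i iN ui; lra.
by have := NP i Ni ui; lra.
Qed.

(** By [low_gap] no entry lies strictly between [a - eta] and [a], so just left of [a] the cut is
    constant and [f_seq] is affine. *)
Lemma derive1_f_seq : derivable (fun t => fine (f_seq u t)) a 1 ->
  derive1 (fun t => fine (f_seq u t)) a =
    fine (psum u' (predC low)) - fine (psum u low).
Proof.
have a01' := a01; move=> df; have [eta e0 gap] := low_gap.
apply: (derive1_left_affine (p := fine (psum u low)) e0 df) => t ta.
have lowt : (fun i => u i < t) = low.
  apply/funext => i; rewrite /low; apply/idP/idP; first by lra.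
  by move=> /gap; lra.
rewrite f_seqE lowt.
have /fineK <- : psum u low \is a fin_num by rewrite ge0_fin_numE ?psum_ge0 ?psum_low_fin.
have /fineK <- : psum u' (predC low) \is a fin_num.
  by rewrite ge0_fin_numE ?psum_ge0 ?psum_high_fin.
by rewrite /=; ring.
Qed.

Hypothesis acc0 : accumulation_point u 0.
Hypothesis acc1 : accumulation_point u 1.

Lemma enumeration_ex : exists sigma tau S T, enumeration sigma tau S T /\
  (derivable (fun t => fine (f_seq u t)) a 1 ->
   derive1 (fun t => fine (f_seq u t)) a = T 0 - S 0).
Proof.
have a01' := a01.
have [||eps e0|sl [sl_inj sl_low sl_surj sl_dec]] := @decreasing_enumeration _ u low.
- rewrite (_ : [set i | low i] = [set i | `|0 - u i| < a]); first by apply: acc0; lra.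
  apply/seteqP; split=> i; rewrite /= /low sub0r normrN ger0_norm //.
- by move=> i _; case/andP: (u01 i).
- exact: (psum_small u_ge0 psum_low_fin).
have [||eps e0|sh [sh_inj sh_high sh_surj sh_dec]] := @decreasing_enumeration _ u' (predC low).
- apply: sub_infinite_set (acc1 (_ : 0 < 1 - a)); last lra.
  move=> i; rewrite /= /low ger0_norm //; lra.
- by move=> i _; have := u01 i; lra.
- exact: (psum_small u'_ge0 psum_high_fin).
(* Entries below [a] go to the negative integers, the largest at -1, and the others to the
   nonnegative ones, so the cut at 0 is the cut at [a]. *)
pose sigma k := match k with Posz n => sh n | Negz n => sl n end.
have lowE k : low (sigma k) = (k < 0).
  by case: k => n /=; [rewrite (negbTE (sh_high n))|rewrite sl_low].
have sigma_inj : injective sigma.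
  move=> k k' kk; have := lowE k; rewrite kk lowE.
  case: k k' kk => n [n'|n'] //= e _; first by rewrite (sh_inj _ _ e).
  by rewrite (sl_inj _ _ e).
have /choice[tau tauK] : forall i, exists k, sigma k = i.
  move=> i; have [il|ih] := boolP (low i).
    by have [n <-] := sl_surj i il; exists (Negz n).
  by have [n <-] := sh_surj i ih; exists (Posz n).
have sigmaK : cancel sigma tau by move=> k; apply: sigma_inj; rewrite tauK.
have step k : u (sigma k) <= u (sigma (k + 1)).
  case: k => n.
    have -> : Posz n + 1 = Posz n.+1 by lia.
    by have /= := sh_dec n; rewrite lerD2l lerN2.
  case: n => [|n]; last first.
    have -> : Negz n.+1 + 1 = Negz n by lia.
    exact: sl_dec.
  have := lowE (Negz 0); have := lowE (Negz 0 + 1); rewrite /low ltNge => /negbFE h1 h2.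
  by apply: (le_trans (ltW _) h1); rewrite h2.
have homo : {homo (fun k => u (sigma k)) : i j / i <= j}.
  move=> i j ij; have -> : j = i + (absz (j - i)%R)%:Z by lia.
  elim: (absz _) => [|n IH]; first by rewrite addr0.
  have -> : i + n.+1%:Z = i + n%:Z + 1 by lia.
  exact: le_trans IH (step _).
pose P (k : int) i := tau i < k.
have P0 : P 0 = low by apply/funext => i; rewrite /P -lowE tauK.
have pS k : psum u (P (k + 1)) = ((u (sigma k))%:E + psum u (P k))%E.
  apply: psum_pick => //; first by rewrite /P sigmaK; lia.
  move=> i; rewrite /P; have [->|ni] := eqVneq i (sigma k); first by rewrite sigmaK; lia.
  have : tau i != k by apply: contra_neq ni => <-; rewrite tauK.
  by lia.
have pT k : psum u' (predC (P k)) = ((u' (sigma k))%:E + psum u' (predC (P (k + 1)%R)))%E.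
  apply: psum_pick => //; first by rewrite /P /= sigmaK; lia.
  move=> i; rewrite /P /=; have [->|ni] := eqVneq i (sigma k); first by rewrite sigmaK; lia.
  have : tau i != k by apply: contra_neq ni => <-; rewrite tauK.
  by lia.
(* Neighbouring cuts differ by one term, so finiteness spreads from the cut at 0. *)
have finS k : psum u (P k) \is a fin_num.
  move: k; apply: int_iff_ind => [k|].
    by rewrite pS fin_numD /=.
  by rewrite P0 ge0_fin_numE ?psum_ge0 ?psum_low_fin.
have finT k : psum u' (predC (P k)) \is a fin_num.
  move: k; apply: int_iff_ind => [k|].
    by rewrite [in X in X <-> _]pT fin_numD /=.
  by rewrite P0 ge0_fin_numE ?psum_ge0 ?psum_high_fin.
pose S k := fine (psum u (P k)); pose T k := fine (psum u' (predC (P k))).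
have cutE k b : 0 <= b <= 1 -> ((1 - b) * S k + b * T k)%:E =
   (\sum_(0 <= i <oo) (if P k i then (1 - b) * u i else b * (1 - u i))%:E)%E.
  by move=> b01; rewrite -cut_series // EFinD !EFinM !fineK.
have fE b : 0 <= b <= 1 -> f_seq u b =
   (\sum_(0 <= i <oo) (if u i < b then (1 - b) * u i else b * (1 - u i))%:E)%E.
  by move=> b01; rewrite f_seqE cut_series.
exists sigma, tau, S, T; split; last by move=> df; rewrite derive1_f_seq // /S /T P0.
split=> //.
- by move=> k; rewrite /S pS fineD //= addrC.
- by move=> k; rewrite /T [in RHS]pT fineD //=; ring.
- by move=> k; apply/fine_ge0/psum_ge0.
- by move=> k; apply/fine_ge0/psum_ge0.
- move=> eps N e0.
  have [||||n0 n0P] := @psum_inter_small _ _ u_ge0 (fun n => P (- n%:Z)) eps.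
  + by move=> n i; rewrite /P; lia.
  + by move=> i; exists (absz (tau i)); rewrite /P; lia.
  + by rewrite P0 psum_low_fin.
  + by [].
  exists (- (maxn n0 (absz (N - 1)%R))%:Z); split; first lia.
  by rewrite -lte_fin fineK //; apply: n0P; lia.
- move=> eps N e0.
  have [||||n0 n0P] := @psum_inter_small _ _ u'_ge0 (fun n => predC (P n%:Z)) eps.
  + by move=> n i; rewrite /P /=; lia.
  + by move=> i; exists (absz (tau i)).+1; rewrite /P /=; lia.
  + by rewrite P0 psum_high_fin.
  + by [].
  exists (maxn n0 (absz (N + 1)%R))%:Z; split; first lia.
  by rewrite -lte_fin fineK //; apply: n0P; lia.
(* Term by term [f_seq] takes the smaller option, as [(1 - b) * u i < b * (1 - u i)] exactly when
   [u i < b]. *)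
- move=> b k b01; rewrite fE ?cutE; [|lra|lra].
  apply: lee_nneseries => i _.
    by case: ifP => _; rewrite lee_fin mulr_ge0 //; lra.
  by rewrite lee_fin; case: ltP => ub; case: ifP => _ //; lra.
(* The cut at [k] and the cut by value can differ only at entries equal to [u (sigma k)], for which
   both options coincide. *)
- move=> k; have b01 := u01 (sigma k).
  rewrite fE ?cutE; [|lra|lra].
  apply: eq_eseriesr => i _; congr (_%:E).
  have [ik|ki] := boolP (P k i).
    have /homo : tau i <= k by rewrite /P in ik; lia.
    rewrite tauK.
    by rewrite le_eqVlt => /orP[/eqP ->|->//]; rewrite ltxx; ring.
  have /homo : k <= tau i by rewrite /P in ki; lia.
  rewrite tauK.
  by rewrite leNgt => /negbTE ->.
Qed.

End Enumeration.

(** * Density of the new span and the final assembly *)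

Lemma lspan_prefix (C : numClosedFieldType) (U : lmodType C) (w : nat -> U) x :
  lspan (fun=> True) w x ->
  exists (n : nat) (c : nat -> C), x = \sum_(i < n) c i *: w i.
Proof.
elim=> [|a i x' _ _ [n [c ->]]]; first by exists 0%N, (fun=> 0); rewrite big_ord0.
(* Coefficients are added, since the index [i] may already occur in the combination. *)
exists (maxn n i.+1), (fun j => (if j == i then a else 0) + (if (j < n)%N then c j else 0)).
under [in RHS]eq_bigr do rewrite scalerDl.
rewrite big_split /=; congr (_ + _).
  have im : (i < maxn n i.+1)%N by rewrite leq_maxr.
  rewrite (bigD1 (Ordinal im)) //= eqxx big1 ?addr0 // => j /eqP ji.
  rewrite ifN ?scale0r //; apply/eqP => jE; apply: ji; exact: val_inj.
rewrite (big_ord_widen (maxn n i.+1) (fun i => c i *: w i)) ?leq_maxl // big_mkcond /=.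
by apply: eq_bigr => j _; case: ifP; rewrite ?scale0r.
Qed.

Lemma accumulation_point_ex (R : realType) (u : nat -> R) (x e : R) :
  accumulation_point u x -> 0 < e -> exists i, `|x - u i| < e.
Proof.
move=> acc e0; apply: contrapT => nex; apply: (acc e e0).
rewrite (_ : [set i | _] = set0) //; apply/seteqP; split=> // i /= ui.
by apply: nex; exists i.
Qed.

Theorem theorem6p2 (R : realType) (lambda d : nat -> R)
    (lambda01 : forall i : nat, 0 < lambda i < 1)
    (d01 : forall i : nat, 0 < d i < 1)
    (lambda_acc0 : accumulation_point lambda 0)
    (lambda_acc1 : accumulation_point lambda 1)
    (d_acc0 : accumulation_point d 0)
    (d_acc1 : accumulation_point d 1)
    (f_le : forall a : R, 0 < a < 1 ->
       (f_seq lambda a <= f_seq d a)%E /\ (f_seq d a < +oo)%E)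
    (f_deriv : exists a : R, [/\ 0 < a < 1,
       derivable (fun t => fine (f_seq lambda t)) a 1,
       derivable (fun t => fine (f_seq d t)) a 1 &
       derive1 (fun t => fine (f_seq lambda t)) a
         - derive1 (fun t => fine (f_seq d t)) a \is a Num.int])
    (H : completeNormedModType R[i]) (ip : {dot H for Num.conj})
    (ip_norm : inner_product_norm ip)
    (E : {linear H -> H}) (E_sa : bounded_self_adjoint ip E)
    (lambda_diag : is_diagonal ip E lambda) :
  is_diagonal ip E d.
Proof.
case: f_deriv => a [a01 dl dd /intrP[s sE]].
have [f_le_a fd_fin] := f_le a a01.
have fl_fin : (f_seq lambda a < +oo)%E by apply: le_lt_trans f_le_a fd_fin.
have [sl [tl [Sl [Tl [el /(_ dl) dlE]]]]] :=
  enumeration_ex lambda01 a01 fl_fin lambda_acc0 lambda_acc1.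
have [sd [td [Sd [Td [ed /(_ dd) ddE]]]]] :=
  enumeration_ex d01 a01 fd_fin d_acc0 d_acc1.
rewrite dlE ddE in sE.
have TS (u : nat -> R) sigma tau S T : enumeration u sigma tau S T ->
    forall k, T k - S k = T 0 - S 0 - k%:~R.
  move=> en; have stepE k : T (k + 1) - S (k + 1) = T k - S k - 1.
    by rewrite (enum_S en) (enum_T en); ring.
  apply: int_iff_ind => [k|]; last by rewrite subr0.
  by rewrite stepE intrD; split; lra.
(* [T - S] drops by 1 at each step, so shifting the list of [d] by the integer [s] makes it agree
   for both sequences. Hence [delta] is also the difference of the [T] sums. *)
pose x k := lambda (sl k); pose y (k : int) := d (sd (k - s)).
pose delta (k : int) := Sd (k - s) - Sl k.
have deltaT k : delta k = Td (k - s) - Tl k.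
  have := TS _ _ _ _ _ el k; have := TS _ _ _ _ _ ed (k - s).
  by rewrite /delta intrB; lra.
have [e [[e_on e_dense] e_diag]] := lambda_diag.
have E_sym : forall u v, ip (E u) v = ip u (E v) by case: E_sa.
have eo : orthonormal_family ip (fun k => e (sl k)).
  by move=> i j; rewrite e_on (can_eq (enum_sigmaK el)).
have ediag : has_diagonal ip E (fun k => e (sl k)) x by move=> k; exact: e_diag.
have [||||||||v [vo vd ev]] := @transport R x y delta _ _ _ _ _ _ _ _ H ip E E_sym _ eo ediag.
- exact: (enum_homo el).
- by move=> i j ij; apply: (enum_homo ed); lia.
- move=> k; have xk := lambda01 (sl k).
  have [|i] := @accumulation_point_ex _ _ _ (1 - x k) lambda_acc1; first by rewrite /x; lra.
  have := lambda01 i; rewrite -(enum_tauK el i) => xi xlt; exists (tl i).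
  by move: xlt; rewrite ger0_norm /x; lra.
- move=> k; have xk := lambda01 (sl k).
  have [|i] := @accumulation_point_ex _ _ _ (x k) lambda_acc0; first by rewrite /x; lra.
  have := lambda01 i; rewrite -(enum_tauK el i) sub0r normrN => xi xlt; exists (tl i).
  by move: xlt; rewrite ger0_norm /x; lra.
- move=> k; rewrite /delta (enum_S el) /x /y.
  have -> : k + 1 - s = (k - s) + 1 by lia.
  by rewrite (enum_S ed); ring.
(* At [a = x k] the cut of [lambda] is exact and that of [d] an upper bound; their difference is
   [(1 - a) * delta k + a * delta k]. *)
- move=> k; have xk := lambda01 (sl k).
  have [] := f_le _ xk; rewrite (enum_f_eq el) => le _.
  have := le_trans le (enum_f_le ed (k - s) xk); rewrite lee_fin.
  have -> : Td (k - s) = Sd (k - s) - Sl k + Tl k by have := deltaT k; rewrite /delta; lra.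
  by rewrite /delta; lra.
(* On the right [delta] is at most the [T] sum of [d]; on the left, next, at most its [S] sum. *)
- move=> eps N e0; have [i [iN Ti]] := enum_T_small ed (N - s) e0.
  exists (i + s); split; first lia.
  rewrite deltaT; have -> : i + s - s = i by lia.
  by have := enum_T_ge0 el (i + s); lra.
- move=> eps N e0; have [i [iN Si]] := enum_S_small ed (N - s) e0.
  exists (i + s); split; first lia.
  rewrite /delta; have -> : i + s - s = i by lia.
  by have := enum_S_ge0 el (i + s); lra.
exists (fun n => v (td n + s)); split; last first.
  move=> n; rewrite vd /y; have -> : td n + s - s = td n by lia.
  by rewrite (enum_tauK ed).
split.
  move=> i j; rewrite vo; congr (_%:R); congr nat_of_bool.
  by rewrite (inj_eq (addIr s)) (can_eq (enum_tauK ed)).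
(* Finite combinations of the old basis are dense, and each one is a finite combination of the new
   vectors. *)
move=> O O0 Oo; have [z [Oz [n [c zE]]]] := e_dense O O0 Oo.
exists z; split=> //=; apply: (lspan_prefix (w := fun n => v (td n + s))); rewrite zE.
have vspan k : lspan (fun=> True) (fun n => v (td n + s)) (v k).
  have -> : v k = (fun n => v (td n + s)) (sd (k - s)).
    by rewrite /= (enum_sigmaK ed) subrK.
  exact: lspan_gen.
elim/big_ind : _ => [|u1 u2|i _]; [exact: lspan0|exact: lspan_add|].
apply: lspan_scale; rewrite -(enum_tauK el i).
by apply: lspan_trans (ev _) => k _; exact: vspan.
Qed.
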